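(* Let $\mathcal G$ be an undirected and connected graph on $\mathcal V=\{1,\dots,n\}$ with adjacency matrix $[a_{i,j}]$, and let $A\in\mathbb R^{m\times m}$, $B\in\mathbb R^{r\times r}$, $C\in\mathbb R^{m\times r}$ be partitioned into blocks $A_i,B_i,C_i$ as described in the context. Assume the Sylvester equation $AX+XB=C$ has at least one exact solution $X\in\mathbb R^{m\times r}$. Consider the following dynamical system in the state $P_e=\mathrm{col}\{\bar X,Y,Z,W,\Theta\}$, with arbitrary initial conditions $X_i(0),W_i(0),\Theta_i(0)\in\mathbb R^{m\times r}$, $Y_i(0)\in\mathbb R^{m_i\times r}$, $Z_i(0)\in\mathbb R^{m\times r_i}$: for all $i\in\mathcal V$ and $t\ge0$, $$\begin{aligned} \dot X_i&=-(X_iB_i-C_i+Z_i)B_i^T-A_i^T(A_iX_i-Y_i)-\sum_{j=1}^n a_{i,j}(X_i-X_j),\\ \dot Y_i&=(A_iX_i-Y_i)-[I_{m_i}]_{\mathcal C}\Theta_i,\\ \dot Z_i&=-(X_iB_i-C_i+Z_i)+\Theta_i[I_{r_i}]_{\mathcal R},\\ \dot W_i&=\sum_{j=1}^n a_{i,j}(\Theta_i-\Theta_j),\\ \dot\Theta_i&=[Y_i]_{\mathcal R}-[Z_i]_{\mathcal C}-\sum_{j=1}^n a_{i,j}(W_i-W_j)-\sum_{j=1}^n a_{i,j}(\Theta_i-\Theta_j). \end{aligned}$$ Then: (i) every equilibrium of this system is Lyapunov stable and every solution is bounded; (ii) the system is globally semi-stable; moreover, the solution $P_e(t)$ with initial condition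 $P_e(0)$ converges exponentially to an equilibrium of the system; (iii) for every $i\in\mathcal V$, the limit $\lim_{t\to\infty}X_i(t)=X^*$ (the same $X^*$ for all $i$) is an exact solution of $AX+XB=C$.
   Context: Graph: $\mathcal G$ has node set $\mathcal V=\{1,\dots,n\}$ and edge set $\mathcal E\subset\mathcal V\times\mathcal V$; its adjacency matrix satisfies $a_{i,j}=a_{j,i}>0$ if $(i,j)\in\mathcal E$ and $a_{i,j}=0$ otherwise. Partition: $m=\sum_{i=1}^n m_i$, $r=\sum_{i=1}^n r_i$ with positive integers $m_i,r_i$; $A=\mathrm{col}\{A_1,\dots,A_n\}$ with $A_i\in\mathbb R^{m_i\times m}$ (row blocks), $B=[B_1,\dots,B_n]$ with $B_i\in\mathbb R^{r\times r_i}$, $C=[C_1,\dots,C_n]$ with $C_i\in\mathbb R^{m\times r_i}$ (column blocks). Notation: $\mathrm{col}\{M_1,\dots,M_n\}=[M_1^T,\dots,M_n^T]^T$. Variables: $X_i,W_i,\Theta_i\in\mathbb R^{m\times r}$, $Y_i\in\mathbb R^{m_i\times r}$, $Z_i\in\mathbb R^{m\times r_i}$; $\bar X=\mathrm{col}\{X_1,\dots,X_n\}$, $W=\mathrm{col}\{W_1,\dots,W_n\}$, $\Theta=\mathrm{col}\{\Theta_1,\dots,\Theta_n\}\in\mathbb R^{mn\times r}$; $Y=\mathrm{col}\{Y_1,\dots,Y_n\}\in\mathbb R^{m\times r}$; $Z=[Z_1,\dots,Z_n]\in\mathbb R^{m\times r}$. Augmented matrices: for a matrix $M$ with $m_i$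 rows, $[M]_{\mathcal R}$ (with index $i$) is the matrix with $m$ rows partitioned into row blocks of sizes $m_1,\dots,m_n$ whose $i$-th row block is $M$ and whose other blocks are zero; for a matrix $M$ with $r_i$ columns, $[M]_{\mathcal C}$ is the matrix with $r$ columns partitioned into column blocks of sizes $r_1,\dots,r_n$ whose $i$-th column block is $M$ and whose other blocks are zero. For identity matrices the same convention gives $[I_{m_i}]_{\mathcal C}=[0_{m_i\times m_1},\dots,I_{m_i},\dots,0_{m_i\times m_n}]\in\mathbb R^{m_i\times m}$ and $[I_{r_i}]_{\mathcal R}=\mathrm{col}\{0_{r_1\times r_i},\dots,I_{r_i},\dots,0_{r_n\times r_i}\}\in\mathbb R^{r\times r_i}$ (identity in the $i$-th block). Semi-stability: a system $\dot x=\phi(x)$ on $\mathbb R^d$ is globally semi-stable if every solution, from any initial condition in $\mathbb R^d$, converges to a Lyapunov stable equilibrium. *)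

(* Defs.v *)
From mathcomp Require Import all_boot all_order all_algebra.
From mathcomp Require Import all_classical all_reals all_analysis.

Set Implicit Arguments.
Unset Strict Implicit.
Unset Printing Implicit Defensive.

Import Order.TTheory GRing.Theory Num.Theory.
Import numFieldNormedType.Exports.

Local Open Scope classical_set_scope.
Local Open Scope ring_scope.

(* Autonomous systems x' = phi x on a normed space V.  For V = 'M[R]_(p, q)
   the norm is the entrywise sup norm; all the notions below are independent
   of the choice of a norm on a finite-dimensional space. *)
Section DynamicalSystems.
Context {R : realType} {V : normedModType R}.
Implicit Types (phi : V -> V) (x : R -> V) (e : V).

(* Trajectories are functions on R of which only the restriction to [0, +oo[
   matters; the derivative at the endpoint t = 0 is the right derivative. *)
Definition is_solution phi x : Prop :=
  (h^-1 *: (x h - x 0) @[h --> 0^'+] --> phi (x 0)) /\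
  (forall t : R, 0 < t -> is_derive t (1 : R) x (phi (x t))).

Definition equilibrium phi e : Prop := phi e = 0.

Definition lyapunov_stable phi e : Prop :=
  forall eps : R, 0 < eps ->
  exists2 delta : R, 0 < delta &
    forall x, is_solution phi x -> `|x 0 - e| < delta ->
    forall t : R, 0 <= t -> `|x t - e| < eps.

Definition globally_semistable phi : Prop :=
  forall x, is_solution phi x ->
  exists e, [/\ equilibrium phi e, lyapunov_stable phi e
              & x t @[t --> +oo] --> e].

Definition converges_exponentially x e : Prop :=
  exists K c : R, 0 < c /\
    forall t : R, 0 <= t -> `|x t - e| <= K * expR (- c * t).

End DynamicalSystems.

Section Graphs.
Context {R : realType} {n : nat}.

Definition undirected_connected (E : rel 'I_n) : Prop :=
  symmetric E /\ forall i j : 'I_n, connect E i j.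

Definition adjacency_matrix (E : rel 'I_n) (a : 'M[R]_n) : Prop :=
  forall i j : 'I_n,
    if E i j then a i j = a j i /\ 0 < a i j else a i j = 0.

End Graphs.

(* [M]_R and [M]_C: the i-th block is M, all others vanish.  For j = i,
   conform_mx only transports M along the (propositional) equality j = i. *)
Section Augmented.
Context {R : realType} {n : nat} {p_ : 'I_n -> nat} {k : nat}.

Definition augR (i : 'I_n) (M : 'M[R]_(p_ i, k)) : 'M[R]_(\sum_j p_ j, k) :=
  \mxcol_j (if j == i then conform_mx 0 M else 0).

Definition augC (i : 'I_n) (M : 'M[R]_(k, p_ i)) : 'M[R]_(k, \sum_j p_ j) :=
  \mxrow_j (if j == i then conform_mx 0 M else 0).

End Augmented.

Section System.
Context {R : realType} {n : nat} {m_ r_ : 'I_n -> nat}.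

Local Notation m := (\sum_(i < n) m_ i)%N.
Local Notation r := (\sum_(i < n) r_ i)%N.
Local Notation mn := (\sum_(i < n) m)%N.

(* The state is the stacked matrix P = col{Xbar, Y, Z, W, Theta}, where
   Xbar = col_i X_i, Y = col_i Y_i, Z = row_i Z_i, W = col_i W_i and
   Theta = col_i Theta_i all have r columns. *)
Local Notation state := 'M[R]_(mn + (m + (m + (mn + mn))), r).

Definition mkstate (X : 'I_n -> 'M[R]_(m, r)) (Y : forall i, 'M[R]_(m_ i, r))
    (Z : forall i, 'M[R]_(m, r_ i)) (W Th : 'I_n -> 'M[R]_(m, r)) : state :=
  col_mx (\mxcol_i X i)
    (col_mx (\mxcol_i Y i)
      (col_mx (\mxrow_i Z i)
        (col_mx (\mxcol_i W i) (\mxcol_i Th i)))).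

Definition stX (P : state) (i : 'I_n) : 'M[R]_(m, r) :=
  submxcol (p_ := fun=> m) (usubmx P) i.
Definition stY (P : state) (i : 'I_n) : 'M[R]_(m_ i, r) :=
  submxcol (usubmx (dsubmx P)) i.
Definition stZ (P : state) (i : 'I_n) : 'M[R]_(m, r_ i) :=
  submxrow (usubmx (dsubmx (dsubmx P))) i.
Definition stW (P : state) (i : 'I_n) : 'M[R]_(m, r) :=
  submxcol (p_ := fun=> m) (usubmx (dsubmx (dsubmx (dsubmx P)))) i.
Definition stTheta (P : state) (i : 'I_n) : 'M[R]_(m, r) :=
  submxcol (p_ := fun=> m) (dsubmx (dsubmx (dsubmx (dsubmx P)))) i.

Definition sylvester_flow (a : 'M[R]_n) (A : 'M[R]_m) (B : 'M[R]_r)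
    (C : 'M[R]_(m, r)) (P : state) : state :=
  let A_ i : 'M[R]_(m_ i, m) := submxcol A i in
  let B_ i : 'M[R]_(r, r_ i) := submxrow B i in
  let C_ i : 'M[R]_(m, r_ i) := submxrow C i in
  let X := stX P in let Y := stY P in let Z := stZ P in
  let W := stW P in let Th := stTheta P in
  mkstate
    (fun i => - (X i *m B_ i - C_ i + Z i) *m (B_ i)^T
              - (A_ i)^T *m (A_ i *m X i - Y i)
              - \sum_(j < n) a i j *: (X i - X j))
    (fun i => (A_ i *m X i - Y i)
              - augC (1%:M : 'M[R]_(m_ i)) *m Th i)
    (fun i => - (X i *m B_ i - C_ i + Z i)
              + Th i *m augR (1%:M : 'M[R]_(r_ i)))
    (fun i => \sum_(j < n) a i j *: (Th i - Th j))
    (fun i => augR (Y i) - augC (Z i)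
              - \sum_(j < n) a i j *: (W i - W j)
              - \sum_(j < n) a i j *: (Th i - Th j)).

End System.

(* Main.v *)
Require Import Defs.
From HB Require Import structures.
From mathcomp Require Import all_boot all_order all_algebra.
From mathcomp Require Import all_classical all_reals all_analysis.
From mathcomp Require Import ring lra.
Set Implicit Arguments.
Unset Strict Implicit.
Unset Printing Implicit Defensive.

Import Order.TTheory GRing.Theory Num.Theory.
Import numFieldNormedType.Exports.

Local Open Scope classical_set_scope.
Local Open Scope ring_scope.

(** The system is affine, and its linear part is dissipative for the Frobenius
inner product of stacked states: it is a primal-dual gradient flow, so the
terms that couple the primal variables with Theta, and W with Theta, are
skew-adjoint and cancel in the energy balance. What remains ([flow0_energy]) is
minus the sum of the squared residuals A_i X_i - Y_i and X_i B_i + Z_i and of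
the disagreements of the X_i and of the Theta_i over the graph. Hence the
distance to any equilibrium never increases, which gives stability and
boundedness as soon as one equilibrium exists; an exact solution X of the
Sylvester equation yields one with X_i = X, Y = A X, Z = C - X B, Theta = 0 and
with W solving a Laplacian equation whose right-hand side sums to zero
([laplacian_solve], [equilibrium_of_solution]).

Dissipativity alone does not give convergence. The additional fact, in the
spirit of LaSalle, is that a state which dissipates nothing, and whose first
two derivatives along the flow dissipate nothing either, has vanishing second
derivative ([flow0_observable]).

Exponential convergence is then proved for every dissipative linear system
x' = x M with this property ([dissipative_exp_cvg]). All the derivatives x M^k
are again trajectories, so the energy V = |x M|^2 + ... + |x M^(K+1)|^2
decreases at the rate of a positive semidefinite quadratic form G. The
observability property, together with the fact that a dissipative M has
ker M^2 = ker M ([dissipative_ker_sqr]), says that G vanishes only on ker M.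
In finite dimension this makes G coercive with respect to |x M|^2
([psd_coercive]), and V is itself bounded by a multiple of |x M|^2; therefore
V' <= - e V and the velocity x M decays exponentially. A curve with an
exponentially small velocity converges exponentially ([integrable_speed_cvg]),
and its limit has zero velocity. Working with the velocity rather than with the
position makes it unnecessary to split off ker M, along which nothing decays.

Finally, two equilibria differ by a state that dissipates nothing, so at every
equilibrium all the X_i are equal and all the residuals vanish; summing the
Theta-equations over the nodes eliminates the Laplacian terms and leaves
A X = Y = Z = C - X B ([equilibrium_solves]). *)

(** * The Frobenius inner product *)

Section FrobeniusProduct.
Context {R : realType}.

Definition frob (p q : nat) (P Q : 'M[R]_(p, q)) : R := \tr (P *m Q^T).

Section Basic.
Context {p q : nat}.
Implicit Types P Q S : 'M[R]_(p, q).

Lemma frobE P Q : frob P Q = \sum_i \sum_j P i j * Q i j.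
Proof.
by apply: eq_bigr => i _; rewrite mxE; apply: eq_bigr => j _; rewrite mxE.
Qed.

Lemma frobC P Q : frob P Q = frob Q P.
Proof. by rewrite /frob -mxtrace_tr trmx_mul trmxK. Qed.

Lemma frobDl P Q S : frob (P + Q) S = frob P S + frob Q S.
Proof. by rewrite /frob mulmxDl mxtraceD. Qed.

Lemma frobDr P Q S : frob S (P + Q) = frob S P + frob S Q.
Proof. by rewrite !(frobC S) frobDl. Qed.

Lemma frobNl P Q : frob (- P) Q = - frob P Q.
Proof. by rewrite /frob mulNmx raddfN. Qed.

Lemma frobNr P Q : frob P (- Q) = - frob P Q.
Proof. by rewrite !(frobC P) frobNl. Qed.

Lemma frobBl P Q S : frob (P - Q) S = frob P S - frob Q S.
Proof. by rewrite frobDl frobNl. Qed.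

Lemma frobBr P Q S : frob S (P - Q) = frob S P - frob S Q.
Proof. by rewrite frobDr frobNr. Qed.

Lemma frobZl c P Q : frob (c *: P) Q = c * frob P Q.
Proof. by rewrite /frob -scalemxAl mxtraceZ. Qed.

Lemma frobZr c P Q : frob P (c *: Q) = c * frob P Q.
Proof. by rewrite !(frobC P) frobZl. Qed.

Lemma frob0l P : frob 0 P = 0.
Proof. by rewrite /frob mul0mx mxtrace0. Qed.

Lemma frob_suml I (s : seq I) (c : pred I) (F : I -> 'M[R]_(p, q)) P :
  frob (\sum_(i <- s | c i) F i) P = \sum_(i <- s | c i) frob (F i) P.
Proof. by rewrite /frob mulmx_suml raddf_sum. Qed.

Lemma frob_ge0 P : 0 <= frob P P.
Proof.
by rewrite frobE sumr_ge0// => i _; rewrite sumr_ge0// => j _; exact: sqr_ge0.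
Qed.

Lemma sqr_entry_le_frob P i j : P i j ^+ 2 <= frob P P.
Proof.
rewrite frobE (bigD1 i)//= (bigD1 j)//= -expr2 -addrA lerDl.
by rewrite addr_ge0 ?sumr_ge0// => *; rewrite ?sumr_ge0// => *; exact: sqr_ge0.
Qed.

Lemma frob_eq0 P : frob P P = 0 -> P = 0.
Proof.
move=> P0; apply/matrixP => i j; rewrite mxE; apply/eqP.
by rewrite -sqrf_eq0 eq_le sqr_ge0 andbT -P0 sqr_entry_le_frob.
Qed.

(** This and the next two lemmas compare the Frobenius norm, for which the flow is
contractive, with the sup norm that defines the topology of matrices. *)
Lemma normm_le_sqrt_frob P : `|P| <= Num.sqrt (frob P P).
Proof.
rewrite [leLHS]/Num.Def.normr/= mx_normrE bigmax_le ?sqrtr_ge0// => -[i j] _ /=.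
by rewrite -sqrtr_sqr ler_wsqrtr// sqr_entry_le_frob.
Qed.

Lemma entry_le_normm P i j : `|P i j| <= `|P|.
Proof.
by rewrite [leRHS]/Num.Def.normr/= mx_normrE (le_bigmax _ _ (i, j)).
Qed.

Lemma frob_le_normm P : frob P P <= (p * q)%:R * (`|P| ^+ 2).
Proof.
rewrite frobE; apply: (@le_trans _ _ (\sum_(i < p) \sum_(j < q) (`|P| ^+ 2))).
  apply: ler_sum => i _; apply: ler_sum => j _.
  by rewrite -expr2 -real_normK ?num_real// lerXn2r ?nnegrE// entry_le_normm.
by rewrite !sumr_const !card_ord -mulrnA mulr_natl mulnC.
Qed.

End Basic.

Lemma frob_mull p q k (A : 'M[R]_(k, p)) (P : 'M[R]_(p, q)) (Q : 'M[R]_(k, q)) :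
  frob (A *m P) Q = frob P (A^T *m Q).
Proof.
by rewrite /frob -mulmxA mxtrace_mulC trmx_mul trmxK mulmxA.
Qed.

Lemma frob_mulr p q k (P : 'M[R]_(p, q)) (A : 'M[R]_(q, k)) (Q : 'M[R]_(p, k)) :
  frob (P *m A) Q = frob P (Q *m A^T).
Proof. by rewrite /frob trmx_mul trmxK mulmxA. Qed.

Lemma frob_mxvec p q (P Q : 'M[R]_(p, q)) : frob (mxvec P) (mxvec Q) = frob P Q.
Proof.
rewrite !frobE big_ord1 (reindex _ (curry_mxvec_bij _ _)) pair_bigA/=.
by apply: eq_bigr => -[i j] _ /=; rewrite !mxvecE.
Qed.

Lemma frob_col_mx p1 p2 q (P1 Q1 : 'M[R]_(p1, q)) (P2 Q2 : 'M[R]_(p2, q)) :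
  frob (col_mx P1 P2) (col_mx Q1 Q2) = frob P1 Q1 + frob P2 Q2.
Proof. by rewrite /frob tr_col_mx mul_col_row mxtrace_block. Qed.

Lemma frob_mxcol n (p_ : 'I_n -> nat) q (P Q : forall i, 'M[R]_(p_ i, q)) :
  frob (\mxcol_i P i) (\mxcol_i Q i) = \sum_i frob (P i) (Q i).
Proof. by rewrite /frob tr_mxcol mul_mxcol_mxrow mxtrace_mxblock. Qed.

Lemma frob_mxrow n (p_ : 'I_n -> nat) q (P Q : forall i, 'M[R]_(q, p_ i)) :
  frob (\mxrow_i P i) (\mxrow_i Q i) = \sum_i frob (P i) (Q i).
Proof. by rewrite /frob tr_mxrow mul_mxrow_mxcol raddf_sum. Qed.

End FrobeniusProduct.

(** * Quadratic forms *)

Section QuadraticForms.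
Context {R : realType}.

Lemma quad_form_bound N (G : 'M[R]_N) :
  exists2 C, 0 < C & forall x : 'rV_N, frob (x *m G) x <= C * frob x x.
Proof.
exists (1 + \sum_k \sum_l `|G k l|).
  by rewrite ltr_pwDl// sumr_ge0// => k _; rewrite sumr_ge0.
move=> x; have x2 k : x 0 k ^+ 2 <= frob x x by exact: sqr_entry_le_frob.
apply: (@le_trans _ _ (\sum_k \sum_l `|G k l| * frob x x)); last first.
  rewrite mulrDl mul1r mulr_suml -[leLHS]add0r lerD ?frob_ge0//.
  by apply: ler_sum => k _; rewrite mulr_suml.
rewrite frobE big_ord1 exchange_big/=; apply: ler_sum => l _.
rewrite mxE mulr_suml; apply: ler_sum => k _.
rewrite -mulrA mulrCA (le_trans (ler_norm _))// normrM ler_wpM2l//.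
rewrite ler_norml; have := x2 k; have := x2 l.
move: (x 0 k) (x 0 l) => u v; move: (frob x x) => w.
have := sqr_ge0 (u + v); have := sqr_ge0 (u - v).
by rewrite !expr2 => *; apply/andP; split; nra.
Qed.

(** The pseudo-inverse solves L = G F: the rows of 1 - G G^+ lie in the kernel of
G, hence in that of L. This is how inclusions of kernels become uniform
bounds. *)
Lemma kermx_factor N1 N2 N3 (G : 'M[R]_(N1, N2)) (L : 'M[R]_(N1, N3)) :
  (forall x : 'rV_N1, x *m G = 0 -> x *m L = 0) -> exists F, L = G *m F.
Proof.
move=> GL; exists (pinvmx G *m L); apply/row_matrixP => i.
rewrite -[L in LHS]mul1mx mulmxA; apply/eqP; rewrite -subr_eq0 -raddfB/=.
rewrite -mulmxBl row_mul GL// -row_mul mulmxBl mul1mx mulmxKpV ?submx_refl//.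
by rewrite subrr row0.
Qed.

(** A replacement for compactness of the unit sphere of a complement of ker G. For
G positive semidefinite, |x G|^2 is at most a multiple of the value of the form
at x; so G vanishes as a form exactly on its kernel, L factors through G, and
|x L|^2 is controlled by |x G|^2. *)
Lemma psd_coercive N N' (G : 'M[R]_N) (L : 'M[R]_(N, N')) :
  G^T = G -> (forall x : 'rV_N, 0 <= frob (x *m G) x) ->
  (forall x : 'rV_N, frob (x *m G) x = 0 -> x *m L = 0) ->
  exists2 C, 0 < C &
    forall x : 'rV_N, frob (x *m L) (x *m L) <= C * frob (x *m G) x.
Proof.
move=> Gsym Gpos GL; have [c c0 Gc] := quad_form_bound G.
have xG2 (x : 'rV_N) : frob (x *m G) (x *m G) <= c * frob (x *m G) x.
  (* A gradient step of length c^-1 cannot make the form negative. *)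
  have := Gpos (x - c^-1 *: (x *m G)).
  rewrite mulmxBl -scalemxAl !frobBl !frobBr !frobZl !frobZr.
  have -> : frob (x *m G *m G) x = frob (x *m G) (x *m G).
    by rewrite frob_mulr Gsym.
  have := Gc (x *m G); move: (frob (x *m G *m G) _) => u.
  move: (frob (x *m G) (x *m G)) (frob (x *m G) x) => v w uv uvw.
  have cK y : c * (c^-1 * y) = y by rewrite mulVKf// gt_eqF.
  have cuv : c^-1 * u <= v by rewrite -(ler_pM2l c0) cK.
  have := mulr_ge0 (ltW c0) uvw.
  by rewrite !mulrBr !cK => *; lra.
have [F LGF] : exists F, L = G *m F.
  apply: kermx_factor => x xG0; apply: GL.
  by rewrite xG0 frob0l.
have [d d0 Fd] := quad_form_bound (F *m F^T).
exists (d * c) => [|x]; first exact: mulr_gt0.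
rewrite LGF mulmxA frob_mulr frobC -mulmxA -mulrA.
by rewrite (le_trans (Fd _))// ler_pM2l.
Qed.

End QuadraticForms.

(** * Scalar differential inequalities *)

Section ScalarDifferentialInequalities.
Context {R : realType}.
Implicit Types (f g : R -> R) (c K : R).

Lemma derive_le0_nonincreasing f g :
  f t @[t --> 0^'+] --> f 0 ->
  (forall t : R, 0 < t -> is_derive t 1 f (g t)) ->
  (forall t : R, 0 < t -> g t <= 0) ->
  forall s t, 0 <= s -> s <= t -> f t <= f s.
Proof.
move=> f0 fg g0; apply: ler0_derive1_nincry => [t|t|].
- by rewrite in_itv/= andbT => /fg [].
- rewrite in_itv/= andbT => t0; have [_ ft] := fg _ t0.
  by rewrite derive1E ft g0.
- apply/continuous_within_itvcyP; split => // t.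
  rewrite in_itv/= andbT => /fg [ft _].
  by apply: differentiable_continuous; apply/derivable1_diffP.
Qed.

Lemma is_derive_expRM c t :
  is_derive t (1 : R) (fun s => expR (c * s)) (c * expR (c * t)).
Proof.
have ct : is_derive t (1 : R) (fun s => c * s) c.
  have := is_deriveZ c (is_derive_id (t : R^o) (1 : R^o)).
  by rewrite -[X in is_derive _ _ _ X]/(c * 1) mulr1.
by rewrite mulrC; exact: (is_derive1_comp (f := expR)).
Qed.

Lemma continuous_expRM c t : expR (c * s) @[s --> t] --> expR (c * t).
Proof.
have [+ _] := is_derive_expRM c t.
by move=> /derivable1_diffP/differentiable_continuous.
Qed.

(** The time K / (a c) contradicts a > 0, because exp u >= 1 + u. *)
Lemma le_expR_decay_le0 a c K : 0 < c ->
  (forall t, 0 <= t -> a <= K * expR (- c * t)) -> a <= 0.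
Proof.
move=> c0 aK; rewrite leNgt; apply/negP => a0.
have K0 : 0 <= K.
  by have := aK 0 (lexx _); rewrite mulr0 expR0 mulr1; apply/le_trans/ltW.
have t0 : 0 <= K / (a * c) by rewrite divr_ge0// mulr_ge0// ltW.
have := aK _ t0; rewrite mulNr expRN ler_pdivlMr ?expR_gt0//.
have ct : 1 + K / a <= expR (c * (K / (a * c))).
  rewrite (_ : c * _ = K / a) ?expR_ge1Dx//; field.
  by rewrite !gt_eqF.
move=> /(le_trans (ler_wpM2l (ltW a0) ct)).
by rewrite mulrDr mulr1 mulrC divfK ?gt_eqF// gerDr leNgt a0.
Qed.

(** The function f t * exp (c t) has a nonpositive derivative. *)
Lemma gronwall_decay f g c :
  f t @[t --> 0^'+] --> f 0 ->
  (forall t : R, 0 < t -> is_derive t 1 f (g t)) ->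
  (forall t : R, 0 < t -> g t <= - c * f t) ->
  forall t, 0 <= t -> f t <= f 0 * expR (- c * t).
Proof.
move=> f0 fg gf t t0.
have : f t * expR (c * t) <= f 0 * expR (c * 0).
  apply: (@derive_le0_nonincreasing (fun t => f t * expR (c * t))
    (fun t => f t * (c * expR (c * t)) + expR (c * t) * g t)) => //.
  - apply: cvgM => //; apply: cvg_at_right_filter.
    exact: continuous_expRM.
  - by move=> s s0; apply: is_deriveM; [exact: fg|exact: is_derive_expRM].
  - move=> s s0; have := gf _ s0; have := expR_gt0 (c * s).
    by move: (expR _) (f s) (g s) => e u v; nra.
by rewrite mulr0 expR0 mulr1 mulNr expRN -ler_pdivlMr ?expR_gt0// => /le_trans; apply.
Qed.

(** With d t = (K / c) exp (- c t), whose derivative is minus the bound on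
the speed, f - d is nondecreasing, f + d is nonincreasing, and d >= 0; the supremum
of f - d is then squeezed between the two at all times. *)
Lemma integrable_speed_cvg f g c K :
  0 < c ->
  f t @[t --> 0^'+] --> f 0 ->
  (forall t : R, 0 < t -> is_derive t 1 f (g t)) ->
  (forall t : R, 0 < t -> `|g t| <= K * expR (- c * t)) ->
  exists l, forall t, 0 <= t -> `|f t - l| <= K / c * expR (- c * t).
Proof.
move=> c0 f0 fg gK.
pose d (t : R) := K / c * expR (- c * t).
have d0 : d t @[t --> 0^'+] --> d 0.
  apply: cvgM; first exact: cvg_cst.
  by apply: cvg_at_right_filter; exact: continuous_expRM.
have dd (t : R) : is_derive t (1 : R) d (- (K * expR (- c * t))).
  have -> : - (K * expR (- c * t)) = K / c * (- c * expR (- c * t)).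
    by move: (expR _) => e; field; rewrite gt_eqF.
  exact: (is_deriveZ (K / c) (is_derive_expRM (- c) t)).
have up s t : 0 <= s -> s <= t -> f t + d t <= f s + d s.
  apply: (@derive_le0_nonincreasing (fun t => f t + d t)
    (fun t => g t + - (K * expR (- c * t)))).
  - exact: cvgD.
  - by move=> u u0; apply: is_deriveD; exact: fg.
  - move=> u u0; have := gK _ u0; rewrite ler_norml => /andP[_].
    by rewrite subr_le0.
have lo s t : 0 <= s -> s <= t -> f s - d s <= f t - d t.
  move=> s0 st; rewrite -lerN2; move: s t s0 st.
  apply: (@derive_le0_nonincreasing (fun t => - (f t - d t))
    (fun t => - (g t - - (K * expR (- c * t))))).
  - by apply: cvgN; exact: cvgB.
  - by move=> u u0; apply: is_deriveN; apply: is_deriveB; exact: fg.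
  - move=> u u0; have := gK _ u0; rewrite ler_norml => /andP[+ _].
    by rewrite oppr_le0 opprK -lerBlDr sub0r.
have K0 : 0 <= K.
  have := le_trans (normr_ge0 _) (gK 1 ltr01).
  by rewrite pmulr_lge0// expR_gt0.
have dge0 t : 0 <= d t by rewrite mulr_ge0 ?expR_ge0// divr_ge0// ltW.
have lu s t : 0 <= s -> 0 <= t -> f s - d s <= f t + d t.
  move=> s0 t0; have [st|/ltW ts] := leP s t.
    by rewrite (le_trans (lo _ _ s0 st))// lerD2l (le_trans _ (dge0 _))// oppr_le0.
  by rewrite (le_trans _ (up _ _ t0 ts))// lerD2l (le_trans _ (dge0 _))// oppr_le0.
pose A := [set f t - d t | t in `[0, +oo[].
have A0 : A !=set0 by exists (f 0 - d 0); exists 0 => //; rewrite /= in_itv/= lexx.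
have Aub t : 0 <= t -> ubound A (f t + d t).
  by move=> t0 _ [s + <-]; rewrite /= in_itv/= andbT => s0; exact: lu.
have hA : has_sup A by split => //; exists (f 0 + d 0); exact: Aub.
exists (sup A) => t t0; rewrite ler_distlC; apply/andP; split.
  by apply: ub_le_sup; [exact: hA.2|exists t => //; rewrite /= in_itv/= t0].
by apply: ge_sup => //; exact: Aub.
Qed.

End ScalarDifferentialInequalities.

(** * Dissipative linear systems *)

Section DissipativeSystems.
Context {R : realType} {N : nat}.
Implicit Types (M G : 'M[R]_N) (x : R -> 'rV[R]_N).

(** Solutions of x' = x M, for row vectors; stating them coordinate by coordinate
reduces everything to real functions of one variable. *)
Definition linear_trajectory M x : Prop := forall k : 'I_N,
  (x t 0 k @[t --> 0^'+] --> x 0 0 k) /\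
  (forall t : R, 0 < t -> is_derive t 1 (fun s => x s 0 k) ((x t *m M) 0 k)).

Definition dissipative M : Prop := forall v : 'rV[R]_N, frob (v *m M) v <= 0.

Lemma frob_mulmxE G (u v : 'rV[R]_N) :
  frob (u *m G) v = \sum_k \sum_l u 0 k * (G k l * v 0 l).
Proof.
rewrite frobE big_ord1 exchange_big/=; apply: eq_bigr => l _.
rewrite mxE mulr_suml; apply: eq_bigr => k _.
by rewrite mulrA.
Qed.

Lemma frob_lyapunov M G (v : 'rV[R]_N) :
  frob (v *m (M *m G + G *m M^T)) v = frob (v *m M *m G) v + frob (v *m G) (v *m M).
Proof. by rewrite mulmxDr frobDl !mulmxA [X in _ + X]frob_mulr trmxK. Qed.

Lemma linear_trajectory_quad_form M x G : linear_trajectory M x ->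
  (frob (x t *m G) (x t) @[t --> 0^'+] --> frob (x 0 *m G) (x 0)) /\
  (forall t : R, 0 < t -> is_derive t 1 (fun s => frob (x s *m G) (x s))
     (frob (x t *m (M *m G + G *m M^T)) (x t))).
Proof.
move=> xM; split.
  rewrite frob_mulmxE; under eq_fun do rewrite frob_mulmxE.
  apply: cvg_big => [|k _]; first exact: add_continuous.
  apply: cvg_big => [|l _]; first exact: add_continuous.
  apply: cvgM; first exact: (xM k).1.
  by apply: cvgM; [exact: cvg_cst|exact: (xM l).1].
move=> t t0.
have -> : (fun s => frob (x s *m G) (x s)) =
    \sum_k \sum_l (fun s => x s 0 k * (G k l * x s 0 l)).
  apply/funext => s; rewrite frob_mulmxE fct_sumE; apply: eq_bigr => k _.
  by rewrite fct_sumE.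
apply: is_derive_eq.
  apply: is_derive_sum => k; apply: is_derive_sum => l.
  apply: is_deriveM; first exact: (xM k).2.
  exact: (is_deriveZ (G k l) ((xM l).2 t t0)).
rewrite frob_lyapunov 2!frob_mulmxE addrC -big_split.
apply: eq_bigr => k _; rewrite -big_split; apply: eq_bigr => l _ /=.
by congr (_ + _); exact: mulrC.
Qed.

(** The energy |x|^2 has derivative 2 <x M, x>. *)
Lemma dissipative_nonexpansive M x t : dissipative M -> linear_trajectory M x ->
  0 <= t -> frob (x t) (x t) <= frob (x 0) (x 0).
Proof.
move=> Mdis xM t0; have [c0 d] := linear_trajectory_quad_form 1%:M xM.
have : frob (x t *m 1%:M) (x t) <= frob (x 0 *m 1%:M) (x 0).
  apply: (derive_le0_nonincreasing c0 d) => // s s0.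
  by rewrite frob_lyapunov !mulmx1 [X in _ + X]frobC; have := Mdis (x s); lra.
by rewrite !mulmx1.
Qed.

(** If z = v M is in the kernel, moving v along z leaves the velocity z unchanged;
dissipativity at v + s z then reads <z, v> + s |z|^2 <= 0 for all s. *)
Lemma dissipative_ker_sqr M (v : 'rV[R]_N) : dissipative M ->
  v *m M *m M = 0 -> v *m M = 0.
Proof.
move=> Mdis; set z := v *m M => zM; apply: frob_eq0.
have zv s : frob z v + s * frob z z <= 0.
  have := Mdis (v + s *: z).
  by rewrite mulmxDl -scalemxAl zM scaler0 addr0 frobDr frobZr.
apply/eqP; rewrite eq_le frob_ge0 andbT leNgt; apply/negP => z0.
have := zv ((1 - frob z v) / frob z z).
by rewrite divfK ?gt_eqF// addrC subrK ler10.
Qed.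

(** The second hypothesis is an observability condition: if neither a state nor its
derivatives up to order K dissipate energy, then the last of these derivatives
vanishes. *)
Theorem dissipative_exp_cvg M K x : dissipative M ->
  (forall v : 'rV[R]_N,
    (forall k, (k <= K)%N -> frob (v *m M ^+ k *m M) (v *m M ^+ k) = 0) ->
    v *m M ^+ K = 0) ->
  linear_trajectory M x ->
  exists (l : 'rV[R]_N) L c, [/\ l *m M = 0, 0 <= L, 0 < c &
    forall t k, 0 <= t -> `|x t 0 k - l 0 k| <= L * expR (- c * t)].
Proof.
move=> Mdis Mobs xM.
(* The ascending chain of the kernels of the powers of M stops at M. *)
have Mpow (v : 'rV[R]_N) k : v *m M ^+ k.+1 = 0 -> v *m M = 0.
  elim: k => [|k IHk]; rewrite ?expr1// => vM; apply: IHk.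
  rewrite exprSr -mulmxE mulmxA; apply: dissipative_ker_sqr => //.
  by rewrite -2!mulmxA !mulmxE -expr2 -exprD addn2.
(* H is the energy of the first K + 1 derivatives, and G the rate at which it is
   dissipated: their total dissipation. *)
pose H := \sum_(k < K.+1) M ^+ k.+1 *m (M ^+ k.+1)^T.
pose G := - (M *m H + H *m M^T).
have HE (v : 'rV[R]_N) : frob (v *m H) v =
    \sum_(k < K.+1) frob (v *m M ^+ k.+1) (v *m M ^+ k.+1).
  rewrite mulmx_sumr frob_suml; apply: eq_bigr => k _.
  by rewrite mulmxA frob_mulr trmxK.
have Hsym : H^T = H.
  by rewrite raddf_sum; apply: eq_bigr => k _ /=; rewrite trmx_mul trmxK.
have Gsym : G^T = G.
  by rewrite linearN/= linearD/= !trmx_mul trmxK Hsym addrC.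
have GE (v : 'rV[R]_N) : frob (v *m G) v =
    \sum_(k < K.+1) (- frob (v *m M *m M ^+ k *m M) (v *m M *m M ^+ k)) *+ 2.
  rewrite mulmxN frobNl frob_lyapunov frob_mulr Hsym frobC -mulr2n.
  rewrite -mulNrn mulmx_sumr frob_suml -sumrN -sumrMnl; apply: eq_bigr => k _.
  rewrite mulmxA frob_mulr trmxK frobC.
  by rewrite [in v *m M *m _]exprSr [in v *m _ ^+ _]exprS -!mulmxE !mulmxA.
have Gpos (v : 'rV[R]_N) : 0 <= frob (v *m G) v.
  rewrite GE sumr_ge0// => k _; rewrite mulrn_wge0// oppr_ge0; exact: Mdis.
have G0 (v : 'rV[R]_N) : frob (v *m G) v = 0 -> v *m M = 0.
  rewrite GE => /eqP; rewrite psumr_eq0 => [/allP vG|k _]; last first.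
    by rewrite mulrn_wge0// oppr_ge0; exact: Mdis.
  apply: (@Mpow _ K); rewrite exprS -mulmxE mulmxA; apply: Mobs => k kK.
  have := vG (Ordinal (kK : (k < K.+1)%N)).
  by rewrite mem_index_enum => /(_ isT); rewrite mulrn_eq0 oppr_eq0 => /eqP.
have [c c0 coer] := psd_coercive Gsym Gpos G0.
pose H' := \sum_(k < K.+1) M ^+ k *m (M ^+ k)^T.
(* The energy depends on the velocity only, so coercivity of G bounds it. *)
have HH' (v : 'rV[R]_N) : frob (v *m H) v = frob (v *m M *m H') (v *m M).
  rewrite HE mulmx_sumr frob_suml; apply: eq_bigr => k _.
  by rewrite mulmxA [RHS]frob_mulr trmxK exprS -mulmxE mulmxA.
have [d d0 H'd] := quad_form_bound H'.
have [V0 dV] := linear_trajectory_quad_form H xM.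
set V := fun t => frob (x t *m H) (x t).
pose e := (d * c)^-1.
have e0 : 0 < e by rewrite invr_gt0 mulr_gt0.
have Vdecay t : 0 <= t -> V t <= V 0 * expR (- e * t).
  apply: (gronwall_decay V0 dV) => s s0.
  have -> : M *m H + H *m M^T = - G by rewrite opprK.
  rewrite mulmxN frobNl mulNr lerN2 ler_pdivrMl ?mulr_gt0// HH'.
  by rewrite (le_trans (H'd _))// -mulrA ler_pM2l.
have speed t k : 0 <= t ->
    `|(x t *m M) 0 k| <= Num.sqrt (V 0) * expR (- (e / 2) * t).
  move=> t0.
  have -> : expR (- (e / 2) * t) = Num.sqrt (expR (- e * t)).
    apply/eqP; rewrite -(@eqrXn2 _ 2)// ?expR_ge0 ?sqrtr_ge0// sqr_sqrtr ?expR_ge0//.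
    by rewrite expr2 -expRD; apply/eqP; congr expR; field.
  rewrite -sqrtrM; last by rewrite /V HE sumr_ge0// => j _; exact: frob_ge0.
  rewrite -sqrtr_sqr ler_wsqrtr// (le_trans _ (Vdecay _ t0))//.
  rewrite (le_trans (sqr_entry_le_frob _ _ _))// /V HE big_ord_recl/= expr1 lerDl.
  by rewrite sumr_ge0// => j _; exact: frob_ge0.
have lim k : {l | forall t, 0 <= t ->
    `|x t 0 k - l| <= Num.sqrt (V 0) / (e / 2) * expR (- (e / 2) * t)}.
  apply: cid; apply: (@integrable_speed_cvg _ _ (fun t => (x t *m M) 0 k)).
  - by rewrite divr_gt0.
  - exact: (xM k).1.
  - exact: (xM k).2.
  - by move=> t /ltW; exact: speed.
pose l := \row_k sval (lim k).
have L0 : 0 <= Num.sqrt (V 0) / (e / 2).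
  by rewrite mulr_ge0 ?sqrtr_ge0// invr_ge0 ltW// divr_gt0.
exists l, (Num.sqrt (V 0) / (e / 2)), (e / 2); split => //; last 2 first.
- by rewrite divr_gt0.
- by move=> t k t0; rewrite mxE; case: (lim k) => /= ? ->.
(* The velocity at the limit differs from the velocity at time t by a quantity
   that is exponentially small in t, and the latter is exponentially small. *)
apply/rowP => k; rewrite [RHS]mxE; apply/eqP; rewrite -normr_le0.
pose C := Num.sqrt (V 0) + Num.sqrt (V 0) / (e / 2) * \sum_j `|M j k|.
apply: (@le_expR_decay_le0 _ _ (e / 2) C); first by rewrite divr_gt0.
move=> t t0; have -> : l *m M = x t *m M - (x t - l) *m M.
  by rewrite mulmxBl opprB addrC subrK.
rewrite mxE (le_trans (ler_normD _ _))// mulrDl lerD ?speed// mxE normrN mxE.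
rewrite (le_trans (ler_norm_sum _ _ _))// mulrAC mulr_sumr; apply: ler_sum => j _.
by rewrite normrM ler_wpM2r// !mxE; case: (lim j) => /= ? ->.
Qed.

End DissipativeSystems.

(** * Dissipative affine systems on matrices *)

Section DissipativeAffineSystems.
Context {R : realType} {p q : nat}.
Local Notation V := 'M[R]_(p, q).
Context (phi : V -> V) (f : {linear V -> V}) (e0 : V) (K : nat).
Context (phiE : forall Q, phi Q = f (Q - e0)).
Context (f_dissipative : forall Q, frob (f Q) Q <= 0).
Context (f_observable : forall Q,
  (forall k, (k <= K)%N -> frob (iter k.+1 f Q) (iter k f Q) = 0) ->
  iter K f Q = 0).

Local Notation M := (lin_mx f).

Lemma phi_sub_equilibrium e Q : equilibrium phi e -> phi Q = f (Q - e).
Proof.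
rewrite /equilibrium !phiE => fe.
by rewrite -[Q - e0](subrKA e) linearD/= fe addr0.
Qed.

(** Centring at an equilibrium and vectorising turn a solution of the affine system
into a trajectory of the matrix of its linear part. At the initial time only a
right derivative is available; it still gives right continuity. *)
Lemma is_solution_linear_trajectory e P : equilibrium phi e ->
  is_solution phi P -> linear_trajectory M (fun t => mxvec (P t - e)).
Proof.
move=> phie [P0 dP] k; case/mxvec_indexP: k => i j; split.
  rewrite mxvecE; under eq_fun do rewrite mxvecE !mxE.
  rewrite !mxE; apply: cvgB; last exact: cvg_cst.
  have P0ij : h^-1 * (P h i j - P 0 i j) @[h --> 0^'+] --> phi (P 0) i j.
    have /differentiable_continuous coordc := differentiable_coord (phi (P 0)) i j.
    have -> : (fun h => h^-1 * (P h i j - P 0 i j)) =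
        (fun N : V => N i j) \o (fun h => h^-1 *: (P h - P 0)).
      by apply/funext => h; rewrite /= !mxE.
    exact: (cvg_comp _ _ P0 coordc).
  have id0 : (h : R) @[h --> 0^'+] --> (0 : R).
    by apply: cvg_at_right_filter; exact: cvg_id.
  have -> : P 0 i j = 0 * phi (P 0) i j + P 0 i j by rewrite mul0r add0r.
  have : h * (h^-1 * (P h i j - P 0 i j)) + P 0 i j @[h --> 0^'+] -->
      0 * phi (P 0) i j + P 0 i j.
    by apply: cvgD; [exact: cvgM|exact: cvg_cst].
  apply: cvg_trans; apply: near_eq_cvg; near=> h.
  by rewrite mulVKf ?subrK//.
move=> t t0; have [Pt DP] := dP _ t0.
have -> : (mxvec (P t - e) *m M) 0 (mxvec_index i j) = phi (P t) i j.
  by rewrite mul_vec_lin mxvecE (phi_sub_equilibrium _ phie).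
have Pij : is_derive t 1 (fun s => P s i j) (phi (P t) i j).
  split; first exact: ((derivable_mxP _ _ _).1 Pt).
  by rewrite -DP derive_mx// mxE.
have -> : (fun s => mxvec (P s - e) 0 (mxvec_index i j)) =
    (fun s => P s i j) - cst (e i j).
  by apply/funext => s; rewrite mxvecE !mxE.
by rewrite -[phi _ _ _]subr0; apply: is_deriveB.
Unshelve. all: by end_near. Qed.

Lemma mxvec_iter k Q : mxvec (iter k f Q) = mxvec Q *m M ^+ k.
Proof.
elim: k => [|k IHk]; first by rewrite mulmx1.
by rewrite iterS -mul_vec_lin IHk exprSr -mulmxE mulmxA.
Qed.

Lemma lin_mx_dissipative : dissipative M.
Proof.
move=> v; rewrite -[v]vec_mxK mul_vec_lin frob_mxvec; exact: f_dissipative.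
Qed.

Lemma lin_mx_observable (v : 'rV[R]_(p * q)) :
  (forall k, (k <= K)%N -> frob (v *m M ^+ k *m M) (v *m M ^+ k) = 0) ->
  v *m M ^+ K = 0.
Proof.
rewrite -[v]vec_mxK -mxvec_iter => vM; rewrite f_observable ?linear0// => k kK.
by have := vM _ kK; rewrite -mxvec_iter mul_vec_lin frob_mxvec.
Qed.

Lemma affine_nonexpansive e P t : equilibrium phi e -> is_solution phi P ->
  0 <= t -> `|P t - e| <= Num.sqrt (p * q)%:R * `|P 0 - e|.
Proof.
move=> phie solP t0; rewrite (le_trans (normm_le_sqrt_frob _))//.
rewrite -[X in _ * X]ger0_norm// -sqrtr_sqr -sqrtrM// ler_wsqrtr//.
rewrite (le_trans _ (frob_le_normm _))//.
have := dissipative_nonexpansive lin_mx_dissipative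
  (is_solution_linear_trajectory phie solP) t0.
by rewrite !frob_mxvec.
Qed.

(** The factor by which distances in the sup norm may grow is at most
sqrt (p q); adding 1 to it keeps the radius well defined for empty matrices. *)
Lemma affine_lyapunov_stable e : equilibrium phi e -> lyapunov_stable phi e.
Proof.
move=> phie eps eps0; set r := Num.sqrt (p * q)%:R : R.
have r0 : 0 < 1 + r by rewrite ltr_pwDl// sqrtr_ge0.
exists (eps / (1 + r)); first by rewrite divr_gt0.
move=> P solP; rewrite ltr_pdivlMr// mulrC => Pe t t0.
rewrite (le_lt_trans (affine_nonexpansive phie solP t0))//.
by rewrite (le_lt_trans _ Pe)// ler_wpM2r// lerDr.
Qed.

Lemma equilibrium_center : equilibrium phi e0.
Proof. by rewrite /equilibrium phiE subrr linear0. Qed.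

Lemma affine_bounded P : is_solution phi P ->
  [bounded P t | t in `[0, +oo[ ].
Proof.
move=> solP; exists (Num.sqrt (p * q)%:R * `|P 0 - e0| + `|e0|).
split; first exact: num_real.
move=> B /ltW PB t; rewrite /= in_itv/= andbT => t0.
rewrite (le_trans _ PB)// -[P t](subrK e0) (le_trans (ler_normD _ _))// lerD2r.
exact: affine_nonexpansive equilibrium_center solP t0.
Qed.

Lemma affine_exp_cvg P : is_solution phi P ->
  exists e, equilibrium phi e /\ converges_exponentially P e.
Proof.
move=> solP.
have traj := is_solution_linear_trajectory equilibrium_center solP.
have [l [L [c [lM L0 c0 lL]]]] :=
  dissipative_exp_cvg lin_mx_dissipative lin_mx_observable traj.
exists (e0 + vec_mx l); split.
  rewrite /equilibrium phiE addrAC subrr add0r; apply: (can_inj mxvecK).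
  by rewrite -mul_vec_lin vec_mxK lM linear0.
exists L, c; split => // t t0.
rewrite [leLHS]/Num.Def.normr/= mx_normrE bigmax_le ?mulr_ge0 ?expR_ge0// => -[i j] _ /=.
by have := lL t (mxvec_index i j) t0; rewrite mxvecE !mxE -addrA opprD addrA.
Qed.

End DissipativeAffineSystems.

Section ExponentialConvergence.
Context {R : realType} {V : normedModType R}.

Lemma converges_exponentially_cvg (x : R -> V) e :
  converges_exponentially x e -> x t @[t --> +oo] --> e.
Proof.
move=> [L [c [c0 xL]]]; apply/cvgrPdist_le => eps eps0.
have /cvgrPdist_le/(_ _ eps0) : L * expR (- (c * t)) @[t --> +oo] --> L * 0.
  apply: cvgM; first exact: cvg_cst.
  apply: (cvg_comp _ _ _ (@cvgr_expR R)).
  exact: gt0_cvgMry c0 cvg_id.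
rewrite mulr0; apply: filterS2 (nbhs_pinfty_ge (num_real 0)) => t t0.
rewrite sub0r normrN distrC; apply: le_trans.
by rewrite (le_trans (xL _ t0))// mulNr ler_norm.
Qed.

End ExponentialConvergence.

(** * Augmented matrices *)

Section AugmentedBlocks.
Context {R : realType} {n : nat} {p_ : 'I_n -> nat}.

Lemma augC1_mul k i (T : 'M[R]_(\sum_j p_ j, k)) :
  augC (1%:M : 'M[R]_(p_ i)) *m T = submxcol T i.
Proof.
rewrite -[T in LHS]submxcolK /augC mul_mxrow_mxcol (bigD1 i)//= eqxx.
rewrite conform_mx_id mul1mx big1 ?addr0// => j /negPf ->.
by rewrite mul0mx.
Qed.

Lemma mul_augR1 k i (T : 'M[R]_(k, \sum_j p_ j)) :
  T *m augR (1%:M : 'M[R]_(p_ i)) = submxrow T i.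
Proof.
rewrite -[T in LHS]submxrowK /augR mul_mxrow_mxcol (bigD1 i)//= eqxx.
rewrite conform_mx_id mulmx1 big1 ?addr0// => j /negPf ->.
by rewrite mulmx0.
Qed.

(** Augmentation is the adjoint of block extraction: this is the reason why the
couplings between Theta and the pair (Y, Z) cancel in the energy balance. *)
Lemma frob_augR k i (Y : 'M[R]_(p_ i, k)) (T : 'M[R]_(\sum_j p_ j, k)) :
  frob (augR Y) T = frob Y (submxcol T i).
Proof.
rewrite -[T in LHS]submxcolK /augR frob_mxcol (bigD1 i)//= eqxx conform_mx_id.
by rewrite big1 ?addr0// => j /negPf ->; rewrite frob0l.
Qed.

Lemma frob_augC k i (Z : 'M[R]_(k, p_ i)) (T : 'M[R]_(k, \sum_j p_ j)) :
  frob (augC Z) T = frob Z (submxrow T i).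
Proof.
rewrite -[T in LHS]submxrowK /augC frob_mxrow (bigD1 i)//= eqxx conform_mx_id.
by rewrite big1 ?addr0// => j /negPf ->; rewrite frob0l.
Qed.

Lemma sum_augR k (Y : forall i, 'M[R]_(p_ i, k)) :
  \sum_i augR (Y i) = \mxcol_i Y i.
Proof.
apply/mxcolP => i; rewrite submxcol_sum mxcolK (bigD1 i)//= mxcolK eqxx.
rewrite conform_mx_id big1 ?addr0// => j ji.
by rewrite mxcolK eq_sym (negPf ji).
Qed.

Lemma sum_augC k (Z : forall i, 'M[R]_(k, p_ i)) :
  \sum_i augC (Z i) = \mxrow_i Z i.
Proof.
apply/mxrowP => i; rewrite submxrow_sum mxrowK (bigD1 i)//= mxrowK eqxx.
rewrite conform_mx_id big1 ?addr0// => j ji.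
by rewrite mxrowK eq_sym (negPf ji).
Qed.

End AugmentedBlocks.

(** * The graph Laplacian *)

Section GraphLaplacian.
Context {R : realType} {n : nat} (E : rel 'I_n) (a : 'M[R]_n).
Context (hE : undirected_connected E) (ha : adjacency_matrix E a).

Lemma adjacency_sym i j : a i j = a j i.
Proof.
have := ha i j; case: ifPn => [_ []//|nE ->].
by have := ha j i; rewrite hE.1 (negPf nE).
Qed.

Lemma adjacency_ge0 i j : 0 <= a i j.
Proof. by have := ha i j; case: ifP => _ => [[_ /ltW]|->]. Qed.

Section Laplacian.
Context {p q : nat}.
Implicit Types X T : 'I_n -> 'M[R]_(p, q).

Definition laplacian X i := \sum_j a i j *: (X i - X j).

(** The Dirichlet form of the graph. Each edge is counted twice, whence the
factor 2. *)
Lemma dirichlet_form X T : (\sum_i frob (laplacian X i) (T i)) *+ 2 =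
  \sum_i \sum_j a i j * frob (X i - X j) (T i - T j).
Proof.
have LE : \sum_i frob (laplacian X i) (T i) =
    \sum_i \sum_j a i j * frob (X i - X j) (T i).
  apply: eq_bigr => i _; rewrite frob_suml; apply: eq_bigr => j _.
  by rewrite frobZl.
rewrite mulr2n {1}LE exchange_big LE -big_split/=; apply: eq_bigr => i _.
rewrite -big_split/=; apply: eq_bigr => j _.
by rewrite (adjacency_sym j i) -mulrDr -(opprB (X i)) frobNl frobBr; ring.
Qed.

Lemma laplacian_selfadjoint X T :
  \sum_i frob (laplacian X i) (T i) = \sum_i frob (laplacian T i) (X i).
Proof.
have := dirichlet_form T X; rewrite mulr2n => TX.
have := dirichlet_form X T; rewrite mulr2n => XT.
suff : \sum_i \sum_j a i j * frob (X i - X j) (T i - T j) =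
  \sum_i \sum_j a i j * frob (T i - T j) (X i - X j) by lra.
by apply: eq_bigr => i _; apply: eq_bigr => j _; rewrite frobC.
Qed.

Lemma laplacian_ge0 X : 0 <= \sum_i frob (laplacian X i) (X i).
Proof.
rewrite -(pmulrn_lge0 _ (isT : (0 < 2)%N)) dirichlet_form.
apply: sumr_ge0 => i _; apply: sumr_ge0 => j _.
by rewrite mulr_ge0 ?frob_ge0 ?adjacency_ge0.
Qed.

(** Connectedness enters here only: a vanishing Dirichlet energy forces equality
along each edge, hence along each path. *)
Lemma laplacian_consensus X : \sum_i frob (laplacian X i) (X i) = 0 ->
  forall i j, X i = X j.
Proof.
move=> X0; have {}X0 : \sum_i \sum_j a i j * frob (X i - X j) (X i - X j) = 0.
  by rewrite -dirichlet_form X0 mul0rn.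
have aX i j : a i j * frob (X i - X j) (X i - X j) = 0.
  move: X0 => /psumr_eq0P X0; apply: (psumr_eq0P _ (X0 _ i isT)) => //.
  - by move=> k _; rewrite mulr_ge0 ?frob_ge0 ?adjacency_ge0.
  - move=> k _; apply: sumr_ge0 => l _.
    by rewrite mulr_ge0 ?frob_ge0 ?adjacency_ge0.
have EX i j : E i j -> X i = X j.
  move=> Eij; have := ha i j; rewrite Eij => -[_ aij].
  have /eqP := aX i j; rewrite mulf_eq0 gt_eqF//= => /eqP/frob_eq0 /eqP.
  by rewrite subr_eq0 => /eqP.
move=> i j; have /connectP[s + ->] := hE.2 i j.
by elim: s i => //= k s IHs i /andP[/EX -> /IHs].
Qed.

Lemma laplacian_const X : (forall i j, X i = X j) -> forall i, laplacian X i = 0.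
Proof.
by move=> XX i; rewrite /laplacian big1// => j _; rewrite (XX i j) subrr scaler0.
Qed.

(** By self-adjointness, the sum is orthogonal to all constant families. *)
Lemma sum_laplacian X : \sum_i laplacian X i = 0.
Proof.
apply: frob_eq0; set S := \sum_i _; rewrite {1}/S frob_suml.
rewrite (laplacian_selfadjoint X (fun=> S)) big1// => i _.
by rewrite laplacian_const ?frob0l.
Qed.

Definition laplacian_mx : 'M[R]_n :=
  \matrix_(i, j) ((i == j)%:R * (\sum_k a i k) - a i j).

Lemma laplacian_mxE X i : laplacian X i = \sum_j laplacian_mx i j *: X j.
Proof.
rewrite /laplacian; under eq_bigr do rewrite scalerBr.
under [RHS]eq_bigr do rewrite mxE scalerBl.
rewrite !sumrB; congr (_ - _); rewrite -scaler_suml [RHS](bigD1 i)//= eqxx mul1r.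
by rewrite [X in _ + X]big1 ?addr0// => j /negPf; rewrite eq_sym => ->; rewrite mul0r scale0r.
Qed.


End Laplacian.

(** The kernel of the Laplacian consists of the constant families, so it is
contained in the kernel of the orthogonal projection Pi onto families of sum
zero; thus Pi = L F, and w = F g solves L w = Pi g = g. *)
Lemma laplacian_solve p q (g : 'I_n -> 'M[R]_(p, q)) : (0 < n)%N ->
  \sum_i g i = 0 -> exists w, forall i, laplacian w i = g i.
Proof.
move=> n0 g0; have nR0 : n%:R != 0 :> R by rewrite pnatr_eq0 -lt0n.
pose Pi : 'M[R]_n := \matrix_(i, j) ((i == j)%:R - n%:R^-1).
have [F PiE] : exists F, Pi = laplacian_mx *m F.
  apply: kermx_factor => x xL.
  pose X i : 'M[R]_1 := (x 0 i)%:M.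
  have XX i j : X i = X j.
    apply: laplacian_consensus; rewrite big1// => k _.
    rewrite (_ : laplacian X k = 0) ?frob0l//.
    have : (x *m laplacian_mx) 0 k = 0 by rewrite xL mxE.
    rewrite mxE laplacian_mxE => xk; rewrite -[RHS](raddf0 (@scalar_mx R 1)) -xk raddf_sum.
    apply: eq_bigr => l _ /=; rewrite /X scale_scalar_mx mulrC !mxE adjacency_sym.
    by rewrite eq_sym; case: eqP => [->|_]; rewrite ?mul0r.
  have xx i j : x 0 i = x 0 j.
    by have /matrixP/(_ 0 0) := XX i j; rewrite !mxE eqxx !mulr1n.
  apply/rowP => j; rewrite !mxE.
  under eq_bigr do rewrite mxE (xx _ j) mulrBr.
  rewrite sumrB (bigD1 j)//= eqxx mulr1 big1 => [|i /negPf ->]; last by rewrite mulr0.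
  by rewrite addr0 sumr_const card_ord -mulrnAr -[_^-1 *+ n]mulr_natl divff// mulr1 subrr.
exists (fun i => \sum_k F i k *: g k) => i; rewrite laplacian_mxE.
transitivity (\sum_k Pi i k *: g k).
  rewrite PiE; under [RHS]eq_bigr do rewrite mxE scaler_suml.
  rewrite exchange_big/=; apply: eq_bigr => j _; rewrite scaler_sumr.
  by apply: eq_bigr => k _; rewrite scalerA.
under eq_bigr do rewrite mxE scalerBl.
rewrite sumrB -scaler_sumr g0 scaler0 subr0 (bigD1 i)//= eqxx scale1r.
by rewrite big1 ?addr0// => j /negPf; rewrite eq_sym => ->; rewrite scale0r.
Qed.

End GraphLaplacian.

(** * Linear maps *)

Section LinearityClosure.
Context {R : realType}.

Section Closure.
Context {U V : lmodType R}.
Implicit Types f g : U -> V.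

Lemma linear_fun_add f g : linear f -> linear g -> linear (fun u => f u + g u).
Proof. by move=> fl gl c u v; rewrite fl gl scalerDr addrACA. Qed.

Lemma linear_fun_opp f : linear f -> linear (fun u => - f u).
Proof. by move=> fl c u v; rewrite fl opprD scalerN. Qed.

Lemma linear_fun_scale b f : linear f -> linear (fun u => b *: f u).
Proof. by move=> fl c u v; rewrite fl scalerDr !scalerA mulrC. Qed.

Lemma linear_fun_sum (I : finType) (F : I -> U -> V) :
  (forall i, linear (F i)) -> linear (fun u => \sum_i F i u).
Proof.
move=> Fl c u v; rewrite scaler_sumr -big_split; apply: eq_bigr => i _.
exact: Fl.
Qed.

Lemma eq_linear f g : f =1 g -> linear g -> linear f.
Proof. by move=> fg gl c u v; rewrite !fg gl. Qed.

End Closure.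

Lemma linear_mulmxl (U : lmodType R) p q k (A : 'M[R]_(p, q)) (f : U -> 'M[R]_(q, k)) :
  linear f -> linear (fun u => A *m f u).
Proof. by move=> fl c u v; rewrite fl mulmxDr scalemxAr. Qed.

Lemma linear_mulmxr (U : lmodType R) p q k (A : 'M[R]_(q, k)) (f : U -> 'M[R]_(p, q)) :
  linear f -> linear (fun u => f u *m A).
Proof. by move=> fl c u v; rewrite fl mulmxDl scalemxAl. Qed.

End LinearityClosure.

(** * Stacked states *)

Section State.
Context {R : realType} {n : nat} {m_ r_ : 'I_n -> nat}.
Local Notation m := (\sum_(i < n) m_ i)%N.
Local Notation r := (\sum_(i < n) r_ i)%N.
Local Notation mn := (\sum_(i < n) m)%N.
Local Notation state := 'M[R]_(mn + (m + (m + (mn + mn))), r).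
Implicit Types P Q : state.

Section Mkstate.
Context (X W Th : 'I_n -> 'M[R]_(m, r)).
Context (Y : forall i, 'M[R]_(m_ i, r)) (Z : forall i, 'M[R]_(m, r_ i)).
Local Notation S := (mkstate X Y Z W Th).

Lemma stX_mk i : stX S i = X i.
Proof. by rewrite /stX col_mxKu mxcolK. Qed.
Lemma stY_mk i : stY S i = Y i.
Proof. by rewrite /stY col_mxKd col_mxKu mxcolK. Qed.
Lemma stZ_mk i : stZ S i = Z i.
Proof. by rewrite /stZ !col_mxKd col_mxKu mxrowK. Qed.
Lemma stW_mk i : stW S i = W i.
Proof. by rewrite /stW !col_mxKd col_mxKu mxcolK. Qed.
Lemma stTheta_mk i : stTheta S i = Th i.
Proof. by rewrite /stTheta !col_mxKd mxcolK. Qed.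

End Mkstate.

Lemma mkstateK P : mkstate (stX P) (stY P) (stZ P) (stW P) (stTheta P) = P.
Proof. by rewrite /mkstate !submxcolK submxrowK !vsubmxK. Qed.

Lemma state_eqP P Q :
  (forall i, [/\ stX P i = stX Q i, stY P i = stY Q i, stZ P i = stZ Q i,
     stW P i = stW Q i & stTheta P i = stTheta Q i]) -> P = Q.
Proof.
move=> PQ; rewrite -[P]mkstateK -[Q]mkstateK.
have -> : stX P = stX Q by apply/funext => i; have [] := PQ i.
have -> : stY P = stY Q by apply: functional_extensionality_dep => i; have [] := PQ i.
have -> : stZ P = stZ Q by apply: functional_extensionality_dep => i; have [] := PQ i.
have -> : stW P = stW Q by apply/funext => i; have [] := PQ i.
by have -> : stTheta P = stTheta Q by apply/funext => i; have [] := PQ i.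
Qed.

Lemma frob_state P Q : frob P Q =
  \sum_i (frob (stX P i) (stX Q i) + frob (stY P i) (stY Q i)
    + frob (stZ P i) (stZ Q i) + frob (stW P i) (stW Q i)
    + frob (stTheta P i) (stTheta Q i)).
Proof.
rewrite -[P in LHS]mkstateK -[Q in LHS]mkstateK /mkstate !frob_col_mx.
by rewrite !frob_mxcol frob_mxrow !big_split/= !addrA.
Qed.

Lemma stX_linear i : linear (fun P => stX P i).
Proof. by move=> c P Q; apply/matrixP => k l; rewrite !mxE. Qed.
Lemma stY_linear i : linear (fun P => stY P i).
Proof. by move=> c P Q; apply/matrixP => k l; rewrite !mxE. Qed.
Lemma stZ_linear i : linear (fun P => stZ P i).
Proof. by move=> c P Q; apply/matrixP => k l; rewrite !mxE. Qed.
Lemma stW_linear i : linear (fun P => stW P i).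
Proof. by move=> c P Q; apply/matrixP => k l; rewrite !mxE. Qed.
Lemma stTheta_linear i : linear (fun P => stTheta P i).
Proof. by move=> c P Q; apply/matrixP => k l; rewrite !mxE. Qed.

Lemma stateD P Q i : [/\ stX (P + Q) i = stX P i + stX Q i,
  stY (P + Q) i = stY P i + stY Q i, stZ (P + Q) i = stZ P i + stZ Q i,
  stW (P + Q) i = stW P i + stW Q i
  & stTheta (P + Q) i = stTheta P i + stTheta Q i].
Proof. by split; apply/matrixP => k l; rewrite !mxE. Qed.

Lemma state0 i : [/\ stX (0 : state) i = 0, stY (0 : state) i = 0,
  stZ (0 : state) i = 0, stW (0 : state) i = 0 & stTheta (0 : state) i = 0].
Proof. by split; apply/matrixP => k l; rewrite !mxE. Qed.

Lemma stX_cvg (P : R -> state) e i :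
  P t @[t --> +oo] --> e -> stX (P t) i @[t --> +oo] --> stX e i.
Proof.
move=> Pe; apply/cvgrPdist_le => eps eps0.
move/cvgrPdist_le : Pe => /(_ _ eps0); apply: filterS => t; apply: le_trans.
rewrite [leLHS]/Num.Def.normr/= mx_normrE bigmax_le// => -[k l] _ /=.
by rewrite !mxE; apply: le_trans (entry_le_normm _ _ l); rewrite !mxE.
Qed.

End State.


(** * The flow and its linear part *)

Section SylvesterFlow.
Context {R : realType} {n : nat} {m_ r_ : 'I_n -> nat}.
Local Notation m := (\sum_(i < n) m_ i)%N.
Local Notation r := (\sum_(i < n) r_ i)%N.
Local Notation mn := (\sum_(i < n) m)%N.
Local Notation state := 'M[R]_(mn + (m + (m + (mn + mn))), r).
Context (a : 'M[R]_n) (A : 'M[R]_m) (B : 'M[R]_r).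
Implicit Types (P Q : state) (C : 'M[R]_(m, r)).

Definition residualA P i : 'M[R]_(m_ i, r) := submxcol A i *m stX P i - stY P i.
(** The constant C is a parameter: C = 0 gives the residual of the linear part of
the flow. *)
Definition residualB C P i : 'M[R]_(m, r_ i) :=
  stX P i *m submxrow B i - submxrow C i + stZ P i.

Section Components.
Context (C : 'M[R]_(m, r)) (P : state) (i : 'I_n).
Local Notation F := (sylvester_flow a A B C P).

Lemma flowX : stX F i = - residualB C P i *m (submxrow B i)^T
  - (submxcol A i)^T *m residualA P i - laplacian a (stX P) i.
Proof. by rewrite stX_mk. Qed.

Lemma flowY : stY F i = residualA P i - submxcol (stTheta P i) i.
Proof. by rewrite stY_mk augC1_mul. Qed.

Lemma flowZ : stZ F i = - residualB C P i + submxrow (stTheta P i) i.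
Proof. by rewrite stZ_mk mul_augR1. Qed.

Lemma flowW : stW F i = laplacian a (stTheta P) i.
Proof. by rewrite stW_mk. Qed.

Lemma flowTheta : stTheta F i = augR (stY P i) - augC (stZ P i)
  - laplacian a (stW P) i - laplacian a (stTheta P) i.
Proof. by rewrite stTheta_mk. Qed.

End Components.

Local Notation F := (sylvester_flow a A B 0).

Lemma laplacian_linear (f : 'I_n -> state -> 'M[R]_(m, r)) i :
  (forall j, linear (f j)) -> linear (fun P => laplacian a (f^~ P) i).
Proof.
move=> fl; rewrite /laplacian.
apply: (linear_fun_sum (F := fun j P => a i j *: (f i P - f j P))) => j.
apply: linear_fun_scale.
by apply: linear_fun_add => //; apply: linear_fun_opp.
Qed.

Lemma residualA_linear i : linear (residualA^~ i).
Proof.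
exact: (linear_fun_add (linear_mulmxl (submxcol A i) (stX_linear i))
  (linear_fun_opp (stY_linear i))).
Qed.

Lemma residualB_linear i : linear (fun P => residualB 0 P i).
Proof.
rewrite /residualB submxrow0 => c P Q; rewrite !subr0.
exact: (linear_fun_add (linear_mulmxr (submxrow B i) (stX_linear i))
  (stZ_linear i)).
Qed.

Lemma augR_linear p (p_ : 'I_n -> nat) i : linear (@augR R n p_ p i).
Proof.
move=> c M N; apply/mxcolP => j; rewrite submxcolD.
have -> : submxcol (c *: augR M) j = c *: submxcol (augR M) j.
  by apply/matrixP => k l; rewrite !mxE.
rewrite !mxcolK; case: eqP => [->|_]; first by rewrite !conform_mx_id.
by rewrite scaler0 addr0.
Qed.

Lemma augC_linear p (p_ : 'I_n -> nat) i : linear (@augC R n p_ p i).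
Proof.
move=> c M N; apply/mxrowP => j; rewrite submxrowD.
have -> : submxrow (c *: augC M) j = c *: submxrow (augC M) j.
  by apply/matrixP => k l; rewrite !mxE.
rewrite !mxrowK; case: eqP => [->|_]; first by rewrite !conform_mx_id.
by rewrite scaler0 addr0.
Qed.

Lemma flow0_linear : linear F.
Proof.
have Thcol i : linear (fun P => submxcol (stTheta P i) i : 'M[R]_(m_ i, r)).
  by move=> c P Q; rewrite stTheta_linear; apply/matrixP => k l; rewrite !mxE.
have Throw i : linear (fun P => submxrow (stTheta P i) i : 'M[R]_(m, r_ i)).
  by move=> c P Q; rewrite stTheta_linear; apply/matrixP => k l; rewrite !mxE.
have augY i : linear (fun P => augR (stY P i)).
  by move=> c P Q; rewrite stY_linear augR_linear.
have augZ i : linear (fun P => augC (stZ P i)).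
  by move=> c P Q; rewrite stZ_linear augC_linear.
move=> c P Q; apply: state_eqP => i; split.
- rewrite stX_linear; exact: (eq_linear (fun P => flowX 0 P i)
    (linear_fun_add (linear_fun_add
      (linear_mulmxr (submxrow B i)^T (linear_fun_opp (residualB_linear i)))
      (linear_fun_opp (linear_mulmxl (submxcol A i)^T (residualA_linear i))))
      (linear_fun_opp (laplacian_linear i stX_linear)))).
- rewrite stY_linear; exact: (eq_linear (fun P => flowY 0 P i)
    (linear_fun_add (residualA_linear i) (linear_fun_opp (Thcol i)))).
- rewrite stZ_linear; exact: (eq_linear (fun P => flowZ 0 P i)
    (linear_fun_add (linear_fun_opp (residualB_linear i)) (Throw i))).
- rewrite stW_linear; exact: (eq_linear (fun P => flowW 0 P i)
    (laplacian_linear i stTheta_linear)).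
- rewrite stTheta_linear; exact: (eq_linear (fun P => flowTheta 0 P i)
    (linear_fun_add (linear_fun_add
      (linear_fun_add (augY i) (linear_fun_opp (augZ i)))
      (linear_fun_opp (laplacian_linear i stW_linear)))
      (linear_fun_opp (laplacian_linear i stTheta_linear)))).
Qed.

Lemma flow_sub C P Q :
  sylvester_flow a A B C P - sylvester_flow a A B C Q = F (P - Q).
Proof.
have FE S : sylvester_flow a A B C S = F S + mkstate
    (fun i => submxrow C i *m (submxrow B i)^T) (fun=> 0)
    (fun i => submxrow C i) (fun=> 0) (fun=> 0).
  set D := mkstate _ _ _ _ _.
  have resE i : residualB C S i = residualB 0 S i - submxrow C i.
    by rewrite /residualB submxrow0 subr0 addrAC.
  have DX i : stX D i = submxrow C i *m (submxrow B i)^T by exact: stX_mk.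
  have DY i : stY D i = 0 by exact: stY_mk.
  have DZ i : stZ D i = submxrow C i by exact: stZ_mk.
  have DW i : stW D i = 0 by exact: stW_mk.
  have DT i : stTheta D i = 0 by exact: stTheta_mk.
  clearbody D.
  apply: state_eqP => i; have [-> -> -> -> ->] := stateD (F S) D i.
  rewrite DX DY DZ DW DT !addr0; split.
  - apply: (etrans (flowX C S i)).
    apply: (etrans _ (congr1 (+%R^~ _) (esym (flowX 0 S i)))).
    by rewrite resE opprB mulmxDl -!addrA addrC !addrA.
  - exact: etrans (flowY C S i) (esym (flowY 0 S i)).
  - apply: (etrans (flowZ C S i)).
    apply: (etrans _ (congr1 (+%R^~ _) (esym (flowZ 0 S i)))).
    by rewrite resE opprB -addrA addrC.
  - exact: etrans (flowW C S i) (esym (flowW 0 S i)).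
  - exact: etrans (flowTheta C S i) (esym (flowTheta 0 S i)).
have linF : F (P - Q) = F P - F Q.
  have PQ : P - Q = -1 *: Q + P by rewrite scaleN1r addrC.
  apply: (etrans (congr1 F PQ)); apply: (etrans (flow0_linear (-1) Q P)).
  by rewrite scaleN1r addrC.
apply: (etrans _ (esym linF)); apply: (etrans (congr2 (fun U V => U - V) (FE P) (FE Q))).
have addrKAr (U V D : state) : U + D - (V + D) = U - V.
  by rewrite opprD addrACA subrr addr0.
exact: addrKAr.
Qed.

End SylvesterFlow.

(** * Energy, observability and equilibria *)

Section ConsensusFlow.
Context {R : realType} {n : nat} {m_ r_ : 'I_n -> nat}.
Local Notation m := (\sum_(i < n) m_ i)%N.
Local Notation r := (\sum_(i < n) r_ i)%N.
Local Notation mn := (\sum_(i < n) m)%N.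
Local Notation state := 'M[R]_(mn + (m + (m + (mn + mn))), r).
Context (E : rel 'I_n) (a : 'M[R]_n) (A : 'M[R]_m) (B : 'M[R]_r).
Context (hE : undirected_connected E) (ha : adjacency_matrix E a).
Implicit Types (P : state) (C : 'M[R]_(m, r)).
Local Notation F := (sylvester_flow a A B 0).
Local Notation resA := (residualA A).
Local Notation resB := (residualB B 0).

(** The couplings of Theta with Y and Z cancel because augmentation and block
extraction are adjoint, at each node separately; the couplings of Theta with W
cancel only after summation over the nodes, by self-adjointness of the
Laplacian. *)
Lemma flow0_energy P : frob (F P) P =
  - (\sum_i (frob (resA P i) (resA P i) + frob (resB P i) (resB P i))
     + \sum_i frob (laplacian a (stX P) i) (stX P i)
     + \sum_i frob (laplacian a (stTheta P) i) (stTheta P i)).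
Proof.
have locE i : frob (stX (F P) i) (stX P i) + frob (stY (F P) i) (stY P i)
    + frob (stZ (F P) i) (stZ P i) + frob (stW (F P) i) (stW P i)
    + frob (stTheta (F P) i) (stTheta P i) =
    (frob (laplacian a (stTheta P) i) (stW P i)
      - frob (laplacian a (stW P) i) (stTheta P i))
    - (frob (resA P i) (resA P i) + frob (resB P i) (resB P i)
      + frob (laplacian a (stX P) i) (stX P i)
      + frob (laplacian a (stTheta P) i) (stTheta P i)).
  have uE : frob (resA P i) (resA P i) =
      frob (resA P i) (submxcol A i *m stX P i) - frob (resA P i) (stY P i).
    by rewrite -frobBr.
  have vE : frob (resB P i) (resB P i) =
      frob (resB P i) (stX P i *m submxrow B i) + frob (resB P i) (stZ P i).
    by rewrite -frobDr {2}/residualB submxrow0 subr0.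
  rewrite flowX flowY flowZ flowW flowTheta {}uE {}vE.
  move: (residualA A P i) (residualB B 0 P i) => u v.
  rewrite !(frobBl, frobDl, frobNl, mulNmx).
  rewrite (frob_mulr v) trmxK (frob_mull _ u) trmxK frob_augR frob_augC.
  by rewrite (frobC (stY P i)) (frobC (stZ P i)); ring.
rewrite frob_state; under eq_bigr do rewrite locE.
rewrite !sumrB (laplacian_selfadjoint hE ha (stW P)) subrr sub0r.
by rewrite !big_split.
Qed.

Lemma flow0_dissipative P : frob (F P) P <= 0.
Proof.
rewrite flow0_energy oppr_le0 !addr_ge0 ?(laplacian_ge0 hE ha)// sumr_ge0// => i _.
by rewrite addr_ge0 ?frob_ge0.
Qed.

Lemma flow0_conservative P : frob (F P) P = 0 ->
  [/\ forall i, resA P i = 0, forall i, resB P i = 0,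
      forall i j, stX P i = stX P j & forall i j, stTheta P i = stTheta P j].
Proof.
rewrite flow0_energy => /eqP; rewrite oppr_eq0.
have res0 i : 0 <= frob (resA P i) (resA P i) + frob (resB P i) (resB P i).
  by rewrite addr_ge0 ?frob_ge0.
rewrite !paddr_eq0 ?addr_ge0 ?(laplacian_ge0 hE ha) ?sumr_ge0//.
move=> /andP[/andP[/eqP/psumr_eq0P r0 /eqP X0] /eqP T0].
have rAB i : frob (resA P i) (resA P i) + frob (resB P i) (resB P i) = 0.
  exact: r0.
split.
- move=> i; apply: frob_eq0; have := rAB i.
  by have := frob_ge0 (resA P i); have := frob_ge0 (resB P i); lra.
- move=> i; apply: frob_eq0; have := rAB i.
  by have := frob_ge0 (resA P i); have := frob_ge0 (resB P i); lra.
- exact: (laplacian_consensus hE ha X0).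
- exact: (laplacian_consensus hE ha T0).
Qed.

(** Let P1 and P2 be the first two derivatives of P. Without dissipation at P the
X- and W-parts of P1 vanish, since they are made of residuals and of Laplacians
of constant families. Without dissipation at P1, zero residuals and X = 0 give
Y = Z = 0, so only the Theta-part of P1 survives, and it is a consensus; hence
in P2 only Y and Z may survive, and they vanish for the same reason, as there
is no dissipation at P2. *)
Lemma flow0_observable P :
  (forall k, (k <= 2)%N -> frob (iter k.+1 F P) (iter k F P) = 0) ->
  iter 2 F P = 0.
Proof.
move=> PF.
have [A0 B0 X0 T0] := flow0_conservative (PF 0%N isT).
have [A1 B1 X1 T1] := flow0_conservative (PF 1%N isT).
have [A2 B2 _ _] := flow0_conservative (PF 2%N isT).
move: A1 B1 X1 T1 A2 B2; rewrite !iterS [iter 0 _ _]/=.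
have restX (Q : state) i : resA Q i = 0 -> resB Q i = 0 ->
    (forall i j, stX Q i = stX Q j) -> stX (F Q) i = 0.
  move=> AQ BQ XQ; rewrite flowX AQ BQ laplacian_const//.
  by rewrite oppr0 mul0mx mulmx0 !subr0.
have resting (Q : state) i : stX Q i = 0 -> resA Q i = 0 -> resB Q i = 0 ->
    stY Q i = 0 /\ stZ Q i = 0.
  rewrite /residualA /residualB submxrow0 => -> /eqP.
  by rewrite mulmx0 mul0mx sub0r oppr_eq0 subr0 add0r => /eqP -> ->.
have P1X i : stX (F P) i = 0 by exact: restX.
have P1W i : stW (F P) i = 0 by rewrite flowW laplacian_const.
move: (F P) P1X P1W => P1 P1X P1W A1 B1 X1 T1.
have P2X i : stX (F P1) i = 0 by exact: restX.
have P2W i : stW (F P1) i = 0 by rewrite flowW laplacian_const.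
have P2T i : stTheta (F P1) i = 0.
  have [Y1 Z1] := resting _ _ (P1X i) (A1 i) (B1 i).
  have aug0R p_ q : augR (0 : 'M[R]_(p_ i, q)) = 0 :> 'M[R]_(\sum_(j < n) p_ j, q).
    by apply: frob_eq0; rewrite frob_augR frob0l.
  have aug0C p_ q : augC (0 : 'M[R]_(q, p_ i)) = 0 :> 'M[R]_(q, \sum_(j < n) p_ j).
    by apply: frob_eq0; rewrite frob_augC frob0l.
  rewrite flowTheta Y1 Z1 aug0R aug0C !laplacian_const ?subr0//.
  by move=> j k; rewrite !P1W.
move: (F P1) P2X P2W P2T => P2 P2X P2W P2T A2 B2.
apply: state_eqP => i; have [Y2 Z2] := resting _ _ (P2X i) (A2 i) (B2 i).
have [-> -> -> -> ->] := @state0 R n m_ r_ i.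
by rewrite P2X P2W P2T Y2 Z2.
Qed.

Lemma equilibrium_of_solution C (X : 'M[R]_(m, r)) : (0 < n)%N ->
  A *m X + X *m B = C ->
  exists e, [/\ equilibrium (sylvester_flow a A B C) e,
    forall i, residualA A e i = 0, forall i, residualB B C e i = 0
  & forall i, stX e i = X].
Proof.
move=> n0 AXB.
have [w wE] : exists w, forall i, laplacian a w i =
    augR (submxcol (A *m X) i) - augC (submxrow (C - X *m B) i).
  apply: (laplacian_solve hE ha n0); rewrite sumrB sum_augR sum_augC.
  by rewrite submxcolK submxrowK -AXB addrK subrr.
pose e : state := mkstate (fun=> X) (submxcol (A *m X)) (submxrow (C - X *m B))
  w (fun=> 0).
have eX i : stX e i = X by exact: stX_mk.
have eY i : stY e i = submxcol (A *m X) i by exact: stY_mk.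
have eZ i : stZ e i = submxrow (C - X *m B) i by exact: stZ_mk.
have eW : stW e = w by apply/funext => i; exact: stW_mk.
have eT i : stTheta e i = 0 by exact: stTheta_mk.
clearbody e; exists e.
have eA i : residualA A e i = 0.
  by rewrite /residualA eX eY submxcol_mul subrr.
have eB i : residualB B C e i = 0.
  by rewrite /residualB eX eZ mul_submxrow submxrowB addrA subrK subrr.
split => //.
have XX i j : stX e i = stX e j by rewrite !eX.
have TT i j : stTheta e i = stTheta e j by rewrite !eT.
apply: state_eqP => i; have [-> -> -> -> ->] := @state0 R n m_ r_ i.
rewrite flowX flowY flowZ flowW flowTheta eA eB (laplacian_const _ XX) (laplacian_const _ TT) eW wE.
rewrite eY eZ eT submxcol0 submxrow0 oppr0 mul0mx mulmx0.
by rewrite !subr0 addr0 subrr.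
Qed.

(** The difference d of two equilibria satisfies F d = 0, so it dissipates nothing:
consensus of the X_i and zero residuals are inherited from the equilibrium
built from an exact solution. *)
Lemma equilibrium_solves C X0 e : (0 < n)%N -> A *m X0 + X0 *m B = C ->
  equilibrium (sylvester_flow a A B C) e ->
  exists Xs, A *m Xs + Xs *m B = C /\ forall i, stX e i = Xs.
Proof.
move=> n0 AXB eqe; have [e0 [eqe0 A0 B0 X0E]] := equilibrium_of_solution n0 AXB.
have Fd : F (e - e0) = 0 by rewrite -(flow_sub a A B C) eqe eqe0 subrr.
have /flow0_conservative[Ad Bd Xd _] : frob (F (e - e0)) (e - e0) = 0.
  by rewrite Fd frob0l.
have eE : e = 1 *: (e - e0) + e0 by rewrite scale1r subrK.
pose i0 := Ordinal n0.
have Xe i : stX e i = stX e i0.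
  by rewrite eE !stX_linear (Xd i i0) !X0E.
have Ae i : residualA A e i = 0.
  by rewrite eE residualA_linear Ad A0 scaler0 addr0.
have Be i : residualB B C e i = 0.
  have resE S : residualB B C S i = residualB B 0 S i - submxrow C i.
    by rewrite /residualB submxrow0 subr0 addrAC.
  by rewrite resE eE residualB_linear Bd scaler0 add0r -resE B0.
exists (stX e i0); split => //.
have Th i : augR (stY e i) - augC (stZ e i) - laplacian a (stW e) i
    - laplacian a (stTheta e) i = 0.
  apply: etrans (esym (flowTheta a A B C e i)) _; rewrite eqe.
  by have [] := @state0 R n m_ r_ i.
(* Summing the Theta-equations over the nodes gives Y = Z. *)
have : \sum_i (augR (stY e i) - augC (stZ e i) - laplacian a (stW e) i
    - laplacian a (stTheta e) i) = 0 by apply: big1 => i _; exact: Th.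
rewrite !sumrB !(sum_laplacian hE ha) !subr0 sum_augR sum_augC => /eqP.
rewrite subr_eq0 => /eqP YZ.
have -> : A *m stX e i0 = \mxcol_i stY e i.
  apply/mxcolP => i; rewrite mxcolK -submxcol_mul -(Xe i).
  by have /eqP := Ae i; rewrite subr_eq0 => /eqP.
rewrite YZ; apply/mxrowP => i; rewrite submxrowD mxrowK -mul_submxrow -(Xe i).
by have /eqP := Be i; rewrite /residualB addrAC subr_eq0 addrC => /eqP.
Qed.

End ConsensusFlow.

(** * Convergence of the distributed algorithm *)

Theorem theorem2 (R : realType) (n : nat) (hn : (0 < n)%N)
    (E : rel 'I_n) (a : 'M[R]_n)
    (hE : undirected_connected E) (ha : adjacency_matrix E a)
    (m_ r_ : 'I_n -> nat)
    (hm : forall i, (0 < m_ i)%N) (hr : forall i, (0 < r_ i)%N)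
    (A : 'M[R]_(\sum_(i < n) m_ i))
    (B : 'M[R]_(\sum_(i < n) r_ i))
    (C : 'M[R]_(\sum_(i < n) m_ i, \sum_(i < n) r_ i))
    (hsol : exists X : 'M[R]_(\sum_(i < n) m_ i, \sum_(i < n) r_ i),
      A *m X + X *m B = C) :
  let phi := sylvester_flow a A B C in
  [/\ (forall e, equilibrium phi e -> lyapunov_stable phi e) /\
      (forall P, is_solution phi P -> [bounded P t | t in `[0, +oo[ ]),
      globally_semistable phi /\
      (forall P, is_solution phi P ->
        exists e, equilibrium phi e /\ converges_exponentially P e)
    & forall P, is_solution phi P ->
        exists Xs : 'M[R]_(\sum_(i < n) m_ i, \sum_(i < n) r_ i),
          A *m Xs + Xs *m B = C /\
          forall i : 'I_n, stX (P t) i @[t --> +oo] --> Xs].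
Proof.
move=> phi; have [X AXB] := hsol.
have [e0 [eqe0 _ _ _]] := equilibrium_of_solution hE ha hn AXB.
pose linF := GRing.isLinear.Build _ _ _ _ _ (@flow0_linear R n m_ r_ a A B).
pose F : {linear _ -> _} := HB.pack (sylvester_flow a A B 0) linF.
have phiE Q : phi Q = F (Q - e0).
  apply: etrans (flow_sub a A B C Q e0).
  by rewrite (eqe0 : sylvester_flow a A B C e0 = 0) subr0.
have Fdis := @flow0_dissipative R n m_ r_ E a A B hE ha.
have Fobs := @flow0_observable R n m_ r_ E a A B hE ha.
have stable e : equilibrium phi e -> lyapunov_stable phi e.
  exact: (affine_lyapunov_stable phiE Fdis).
have expcvg P : is_solution phi P ->
    exists e, equilibrium phi e /\ converges_exponentially P e.
  exact: (affine_exp_cvg phiE Fdis Fobs).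
split; [split|split|] => //.
- by move=> P; exact: (affine_bounded phiE Fdis).
- move=> P /expcvg[e [eqe Pe]]; exists e; split => //; first exact: stable.
  exact: converges_exponentially_cvg.
- move=> P /expcvg[e [eqe /converges_exponentially_cvg Pe]].
  have [Xs [AXs Xe]] := equilibrium_solves hE ha hn AXB eqe.
  by exists Xs; split => // i; rewrite -(Xe i); exact: stX_cvg.
Qed.
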